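(* Let $a,x_0,x_1\in\mathbb{Z}$ and let $(x_n)_{n\geq 0}$ be the second-order linear recurrence with initial values $x_0,x_1$ satisfying $$x_n=2ax_{n-1}-a^2x_{n-2}$$ for all integers $n\geq 2$. Then the quotient set $R((x_n)_{n\geq 0})$ is dense in $\mathbb{Q}_p$ for all primes $p$ satisfying $p\nmid a(x_1-ax_0)$.
   Context: For a set of integers $A$, the quotient set (ratio set) of $A$ is $R(A)=\{a/b : a,b\in A,\ b\neq 0\}$; for a sequence $(x_n)_{n\ge 0}$ of integers, its quotient set $R((x_n)_{n\ge0})$ is $R(\{x_n : n\geq 0\})$. $\mathbb{Q}_p$ is the field of $p$-adic numbers, and denseness is with respect to the $p$-adic metric, with $R(A)\subset\mathbb{Q}\subset\mathbb{Q}_p$. *)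

(* Defs.v *)
From HB Require Import structures.
From mathcomp Require Import all_boot all_order all_algebra.
From mathcomp Require Import generic_quotient ring_quotient.
From mathcomp Require Import all_classical all_reals all_analysis.
From mathcomp Require Import ring lra zify.

Set Implicit Arguments.
Unset Strict Implicit.
Unset Printing Implicit Defensive.

Import Order.TTheory GRing.Theory Num.Theory.
Local Open Scope classical_set_scope.
Local Open Scope ring_scope.

Definition quotient_set (A : set int) : set rat :=
  [set q | exists a b : int, [/\ A a, A b, b != 0 & q = a%:~R / b%:~R]].

(* The p-adic valuation; its value at 0 is irrelevant. *)
Definition padic_val (p : nat) (q : rat) : int :=
  (logn p `|numq q|%N)%:Z - (logn p `|denq q|%N)%:Z.

(* `rat`-valued, since p-adic absolute values are powers of p (or 0). *)
Definition padic_abs (p : nat) (q : rat) : rat :=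
  if q == 0 then 0 else p%:R ^ (- padic_val p q).

Definition padic_cauchy (p : nat) (u : nat -> rat) : Prop :=
  forall e : rat, 0 < e -> exists n0 : nat, forall m n : nat,
    (n0 <= m)%N -> (n0 <= n)%N -> padic_abs p (u m - u n) < e.

Definition padic_null (p : nat) (u : nat -> rat) : Prop :=
  forall e : rat, 0 < e -> exists n0 : nat, forall n : nat,
    (n0 <= n)%N -> padic_abs p (u n) < e.

(* Here the limit is taken for the usual, archimedean, metric on rat. *)
Definition padic_abs_lim (p : nat) (u : nat -> rat) (l : rat) : Prop :=
  forall e : rat, 0 < e -> exists n0 : nat, forall n : nat,
    (n0 <= n)%N -> `|padic_abs p (u n) - l| < e.

Section PadicAbs.
Variables (p : nat) (p_pr : prime p).
Local Notation N := (padic_abs p).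

Let p_gt0 : 0 < (p%:R : rat). Proof. by rewrite ltr0n prime_gt0. Qed.
Let p_neq0 : (p%:R : rat) != 0. Proof. by rewrite gt_eqF. Qed.
Let p_gt1 : 1 < (p%:R : rat). Proof. by rewrite ltr1n prime_gt1. Qed.

Lemma padic_abs_ge0 q : 0 <= N q.
Proof. by rewrite /padic_abs; case: ifP => // _; rewrite exprz_ge0 // ltW. Qed.

Lemma padic_abs_eq0 q : (N q == 0) = (q == 0).
Proof.
rewrite /padic_abs; case: ifP => [_|_]; first by rewrite eqxx.
by rewrite expfz_eq0 (negPf p_neq0) andbF.
Qed.

Lemma padic_abs0 : N 0 = 0. Proof. by rewrite /padic_abs eqxx. Qed.

Lemma padic_abs_frac (m n : int) : m != 0 -> n != 0 ->
  N (m%:~R / n%:~R) =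
  p%:R ^ ((logn p `|n|%N)%:Z - (logn p `|m|%N)%:Z).
Proof.
move=> m0 n0; set q : rat := _ / _.
have q0 : q != 0 by rewrite mulf_neq0 ?invr_eq0 ?intr_eq0.
rewrite /padic_abs (negPf q0) /padic_val; congr (_ ^ _).
have e : (numq q * n = m * denq q)%R.
  apply: (@intr_inj rat); rewrite !rmorphM /=.
  have nn : (n%:~R : rat) != 0 by rewrite intr_eq0.
  have dd : ((denq q)%:~R : rat) != 0 by rewrite intr_eq0 denq_neq0.
  by rewrite -[in LHS](divfK dd (numq q)%:~R) divq_num_den mulrAC divfK.
move: e => /(congr1 (logn p \o absz)) /=.
rewrite !abszM !lognM ?absz_gt0 ?numq_eq0 ?denq_neq0 // => e.
lia.
Qed.

Lemma padic_absE q : q != 0 ->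
  N q = p%:R ^ ((logn p `|denq q|%N)%:Z - (logn p `|numq q|%N)%:Z).
Proof. by move=> q0; rewrite /padic_abs (negPf q0) /padic_val opprB. Qed.

Lemma padic_abs1 : N 1 = 1.
Proof. by rewrite padic_absE ?oner_eq0 // subrr expr0z. Qed.

Lemma padic_absN q : N (- q) = N q.
Proof.
have [->|q0] := eqVneq q 0; first by rewrite oppr0.
by rewrite !padic_absE ?oppr_eq0 // numqN denqN abszN.
Qed.

Lemma padic_absM x y : N (x * y) = N x * N y.
Proof.
have [->|x0] := eqVneq x 0; first by rewrite mul0r padic_abs0 mul0r.
have [->|y0] := eqVneq y 0; first by rewrite mulr0 padic_abs0 mulr0.
rewrite -{1}(divq_num_den x) -{1}(divq_num_den y) mulf_div -!intrM.
rewrite padic_abs_frac ?mulf_neq0 ?numq_eq0 ?denq_neq0 //.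
rewrite !padic_absE // -expfzDr //; congr (_ ^ _).
rewrite !abszM !lognM ?absz_gt0 ?numq_eq0 ?denq_neq0 //.
lia.
Qed.

Lemma padic_absV x : N x^-1 = (N x)^-1.
Proof.
have [->|x0] := eqVneq x 0; first by rewrite !(padic_abs0, invr0).
have nx : N x != 0 by rewrite padic_abs_eq0.
by apply: (mulfI nx); rewrite -padic_absM !divff // padic_abs1.
Qed.

Lemma padic_abs_le1 z : N z <= 1 -> logn p `|denq z|%N = 0%N.
Proof.
have [->|z0] := eqVneq z 0; first by rewrite logn1.
rewrite padic_absE // => h.
apply/eqP; rewrite -leqn0 leqNgt; apply/negP => d0.
have pd : (p %| `|denq z|)%N by move: d0; rewrite logn_gt0 mem_primes => /and3P[].
have pn : ~~ (p %| `|numq z|)%N.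
  apply/negP => pn; have := coprime_num_den z; rewrite /coprime => /eqP g.
  have : (p %| 1)%N by rewrite -g dvdn_gcd pn pd.
  by rewrite dvdn1 => /eqP p1; move: p_pr; rewrite p1.
have ln : logn p `|numq z|%N = 0%N.
  by apply/eqP; rewrite lognE (negPf pn) !andbF.
move: h; rewrite ln subr0 -exprnP leNgt => /negP; apply.
by rewrite exprn_egt1 // -lt0n.
Qed.

Lemma padic_abs_1D z : N z <= 1 -> N (1 + z) <= 1.
Proof.
move=> /padic_abs_le1 h; have [->|z0] := eqVneq (1 + z) 0.
  by rewrite padic_abs0.
have dd : ((denq z)%:~R : rat) != 0 by rewrite intr_eq0 denq_neq0.
have e : 1 + z = (denq z + numq z)%:~R / (denq z)%:~R.
  by rewrite rmorphD /= mulrDl divff // divq_num_den.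
have n0 : denq z + numq z != 0.
  by apply: contra_neq z0 => n0; rewrite e n0 mul0r.
rewrite e padic_abs_frac ?denq_neq0 // h sub0r -exprnN invf_le1.
  by rewrite exprn_ege1 // ltW.
by rewrite exprn_gt0.
Qed.

Lemma padic_abs_maxD x y : N (x + y) <= Num.max (N x) (N y).
Proof.
wlog yx : x y / N y <= N x.
  move=> H; case/orP: (le_total (N y) (N x)) => [|xy]; first exact: H.
  by rewrite addrC maxC; exact: H.
rewrite (max_idPl yx); have [x0|x0] := eqVneq x 0.
  move: yx; rewrite x0 padic_abs0 add0r => h; exact: h.
have -> : x + y = x * (1 + y / x) by rewrite mulrDr mulr1 mulrC divfK.
rewrite padic_absM ler_piMr ?padic_abs_ge0 // padic_abs_1D //.
rewrite padic_absM padic_absV ler_pdivrMr ?mul1r //.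
by rewrite lt_neqAle eq_sym padic_abs_eq0 x0 padic_abs_ge0.
Qed.

Lemma padic_absD x y : N (x + y) <= N x + N y.
Proof.
apply: (le_trans (padic_abs_maxD x y)).
by rewrite ge_max lerDl lerDr !padic_abs_ge0.
Qed.

Lemma padic_abs_distC x y : N (x - y) = N (y - x).
Proof. by rewrite -padic_absN opprB. Qed.

Lemma padic_abs_dist x y : `|N x - N y| <= N (x - y).
Proof.
have h a b : N a - N b <= N (a - b).
  by rewrite lerBlDr -{1}(subrK b a) padic_absD.
by rewrite ler_norml h andbT lerNl opprB padic_abs_distC h.
Qed.

Lemma padic_abs_isosceles x y : N (x - y) < N y -> N x = N y.
Proof.
move=> h; apply/eqP; rewrite eq_le; apply/andP; split.
  rewrite -{1}(subrK y x); apply: (le_trans (padic_abs_maxD _ _)).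
  by rewrite ge_max lexx andbT ltW.
rewrite leNgt; apply/negP => xy.
have := padic_abs_maxD (y - x) x; rewrite subrK padic_abs_distC.
by rewrite le_max leNgt h /= leNgt xy.
Qed.

Lemma padic_cauchy_cst q : padic_cauchy p (fun=> q).
Proof. by move=> e e0; exists 0%N => m n _ _; rewrite subrr padic_abs0. Qed.

Lemma padic_cauchyB u v :
  padic_cauchy p u -> padic_cauchy p v -> padic_cauchy p (u - v).
Proof.
move=> cu cv e e0; have [a ha] := cu _ e0; have [b hb] := cv _ e0.
exists (maxn a b) => m n; rewrite !geq_max => /andP[am bm] /andP[an bn].
have -> : (u - v) m - (u - v) n = (u m - u n) + (v n - v m).
  by rewrite !fctE; ring.
by apply: (le_lt_trans (padic_abs_maxD _ _)); rewrite gt_max ha ?hb.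
Qed.

Lemma padic_cauchy_bounded u : padic_cauchy p u ->
  exists2 B : rat, 0 < B & exists n0, forall n, (n0 <= n)%N -> N (u n) <= B.
Proof.
move=> /(_ 1 ltr01) [a ha]; exists (N (u a) + 1).
  by rewrite ltr_wpDl ?padic_abs_ge0.
exists a => n an; rewrite -{1}(subrK (u a) (u n)) addrC.
by apply: (le_trans (padic_absD _ _)); rewrite lerD2l ltW // ha.
Qed.

Lemma padic_nullM u v :
  padic_cauchy p u -> padic_null p v -> padic_null p (u * v).
Proof.
move=> /padic_cauchy_bounded[B B0 [a ha]] nv e e0.
have [b hb] := nv _ (divr_gt0 e0 B0).
exists (maxn a b) => n; rewrite geq_max => /andP[an bn].
rewrite fctE padic_absM; apply: (@le_lt_trans _ _ (B * N (v n))).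
  by rewrite ler_wpM2r ?padic_abs_ge0 ?ha.
by rewrite mulrC -ltr_pdivlMr // hb.
Qed.

Lemma padic_nullD u v :
  padic_null p u -> padic_null p v -> padic_null p (u + v).
Proof.
move=> nu nv e e0; have [a ha] := nu _ e0; have [b hb] := nv _ e0.
exists (maxn a b) => n; rewrite geq_max => /andP[an bn].
apply: (le_lt_trans (padic_abs_maxD _ _)).
by rewrite gt_max ha ?hb.
Qed.

Lemma padic_cauchyM u v :
  padic_cauchy p u -> padic_cauchy p v -> padic_cauchy p (u * v).
Proof.
move=> cu cv e e0.
have [B B0 [a ha]] := padic_cauchy_bounded cu.
have [C C0 [b hb]] := padic_cauchy_bounded cv.
have [c hc] := cu _ (divr_gt0 e0 C0); have [d hd] := cv _ (divr_gt0 e0 B0).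
exists (maxn (maxn a b) (maxn c d)) => m n; rewrite !geq_max.
move=> /andP[/andP[am bm] /andP[cm dm]] /andP[/andP[an bn] /andP[cn dn]].
have -> : (u * v) m - (u * v) n = u m * (v m - v n) + (u m - u n) * v n.
  by rewrite !fctE; ring.
apply: (le_lt_trans (padic_abs_maxD _ _)); rewrite gt_max !padic_absM.
apply/andP; split.
  apply: (@le_lt_trans _ _ (B * N (v m - v n))).
    by rewrite ler_wpM2r ?padic_abs_ge0 ?ha.
  by rewrite mulrC -ltr_pdivlMr // hd.
apply: (@le_lt_trans _ _ (N (u m - u n) * C)).
  by rewrite ler_wpM2l ?padic_abs_ge0 ?hb.
by rewrite -ltr_pdivlMr // hc.
Qed.

Lemma padic_cauchy_stab u : padic_cauchy p u -> ~ padic_null p u ->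
  exists2 v : rat, 0 < v & exists n0, forall n, (n0 <= n)%N -> N (u n) = v.
Proof.
move=> cu; move/existsNP => [e] /not_implyP[e0] /forallNP nu.
have [a ha] := cu _ e0.
have /existsNP[n /not_implyP[an /negP]] := nu a; rewrite -leNgt => en.
exists (N (u n)); first exact: lt_le_trans en.
exists a => m am; apply: padic_abs_isosceles.
by apply: lt_le_trans en; apply: ha.
Qed.

Lemma padic_cauchyV u : padic_cauchy p u -> ~ padic_null p u ->
  padic_cauchy p (fun n => (u n)^-1).
Proof.
move=> cu nu; have [v v0 [a ha]] := padic_cauchy_stab cu nu.
move=> e e0; have [|b hb] := cu (e * (v * v)); first by rewrite !mulr_gt0.
exists (maxn a b) => m n; rewrite !geq_max => /andP[am bm] /andP[an bn].
have un k : (a <= k)%N -> u k != 0.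
  by move=> ak; rewrite -(padic_abs_eq0) ha // gt_eqF.
have -> : (u m)^-1 - (u n)^-1 = (u n - u m) / (u m * u n).
  by field; rewrite !un.
rewrite padic_absM padic_absV padic_absM !ha // ltr_pdivrMr ?mulr_gt0 //.
exact: hb.
Qed.

Lemma padic_abs_lim_ex u : padic_cauchy p u -> exists l, padic_abs_lim p u l.
Proof.
move=> cu; have [nu|nu] := pselect (padic_null p u).
  exists 0 => e /nu[a ha]; exists a => n an.
  by rewrite subr0 ger0_norm ?padic_abs_ge0 // ha.
have [v v0 [a ha]] := padic_cauchy_stab cu nu.
by exists v => e e0; exists a => n an; rewrite ha // subrr normr0.
Qed.

Lemma padic_abs_lim_eq u v a b : padic_null p (u - v) ->
  padic_abs_lim p u a -> padic_abs_lim p v b -> a = b.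
Proof.
move=> nuv ua vb; apply/eqP; rewrite -subr_eq0 -normr_le0.
apply/ler_addgt0Pl => e e0; rewrite addr0.
have e3 : 0 < e / 3 by rewrite divr_gt0.
have [k hk] := nuv _ e3; have [l hl] := ua _ e3; have [m hm] := vb _ e3.
pose n := maxn k (maxn l m).
have := hk n (leq_maxl _ _).
have := hl n (leq_trans (leq_maxl _ _) (leq_maxr _ _)).
have := hm n (leq_trans (leq_maxr _ _) (leq_maxr _ _)).
have := padic_abs_dist (u n) (v n); rewrite -[(u - v) n]/(u n - v n).
rewrite !ler_norml !ltr_norml => /andP[h1 h2] /andP[h3 h4] /andP[h5 h6] h7.
by apply/andP; split; lra.
Qed.

End PadicAbs.

Definition padic_cauchy_pred (p : nat) (_ : prime p) : {pred nat -> rat} :=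
  fun u => `[< padic_cauchy p u >].

Section CauchyRing.
Variables (p : nat) (p_pr : prime p).

Lemma padic_cauchy_subring : subring_closed (padic_cauchy_pred p_pr).
Proof.
split; first exact/asboolP/padic_cauchy_cst.
- by move=> u v /asboolP cu /asboolP cv; apply/asboolP/padic_cauchyB.
- by move=> u v /asboolP cu /asboolP cv; apply/asboolP/padic_cauchyM.
Qed.

HB.instance Definition _ := GRing.isSubringClosed.Build (nat -> rat)
  (padic_cauchy_pred p_pr) padic_cauchy_subring.

Record padic_cauchy_seq := PadicCauchySeq {
  padic_seq :> nat -> rat;
  padic_seqP : padic_seq \in padic_cauchy_pred p_pr
}.

HB.instance Definition _ := [isSub for padic_seq].
HB.instance Definition _ := [Choice of padic_cauchy_seq by <:].
HB.instance Definition _ :=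
  [SubChoice_isSubComNzRing of padic_cauchy_seq by <:].

Lemma padic_seq_cauchy (u : padic_cauchy_seq) : padic_cauchy p u.
Proof. by apply/asboolP; exact: padic_seqP. Qed.

Definition padic_null_pred : {pred padic_cauchy_seq} :=
  fun u => `[< padic_null p u >].

Lemma padic_null_ideal : idealr_closed padic_null_pred.
Proof.
split.
- by apply/asboolP => e e0; exists 0%N => n _; rewrite padic_abs0.
- apply/negP => /asboolP /(_ 1 ltr01)[a] /(_ a (leqnn a)).
  by rewrite (padic_abs1 p) ltxx.
- move=> u v w /asboolP nv /asboolP nw; apply/asboolP.
  apply: padic_nullD => //; apply: padic_nullM => //.
  exact: padic_seq_cauchy.
Qed.

HB.instance Definition _ := isIdealr.Build padic_cauchy_seq padic_null_pred
  padic_null_ideal.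

End CauchyRing.

(* The field of p-adic numbers, as the completion of rat for padic_abs p:
   Cauchy sequences modulo null sequences. *)
Definition Qp (p : nat) (p_pr : prime p) : Type :=
  {ideal_quot (@padic_null_pred p p_pr)}.

HB.instance Definition _ (p : nat) (p_pr : prime p) :=
  NzRingQuotient.on (Qp p_pr).
HB.instance Definition _ (p : nat) (p_pr : prime p) :=
  GRing.ComNzRing.on (Qp p_pr).

Section QpField.
Variables (p : nat) (p_pr : prime p).
Local Notation T := (padic_cauchy_seq p_pr).
Local Notation K := (Qp p_pr).
Local Open Scope quotient_scope.

Lemma Qp_pi_eq (u v : T) :
  \pi_K u = \pi_K v <-> padic_null p ((u : nat -> rat) - v).
Proof.
split.
  by move/eqP; rewrite -Quotient.idealrBE => /asboolP.
by move=> h; apply/eqP; rewrite -Quotient.idealrBE; apply/asboolP.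
Qed.

Lemma Qp_pi_eq0 (u : T) : \pi_K u = 0 <-> padic_null p u.
Proof.
have <- : \pi_K 0 = 0 :> K by rewrite rmorph0.
by rewrite Qp_pi_eq subr0.
Qed.

Lemma Qp_repr_null (x : K) : x != 0 -> ~ padic_null p (repr x).
Proof. by move=> /eqP x0 /Qp_pi_eq0; rewrite reprK. Qed.

Definition Qp_inv (x : K) : K :=
  match pselect (x != 0) with
  | left x0 => \pi_K (PadicCauchySeq (asboolT
      (padic_cauchyV p_pr (padic_seq_cauchy (repr x)) (Qp_repr_null x0))))
  | right _ => 0
  end.

Lemma Qp_mulVf (x : K) : x != 0 -> Qp_inv x * x = 1.
Proof.
move=> x0; rewrite /Qp_inv; case: pselect => // x0'.
rewrite -[X in _ * X]reprK -rmorphM -(rmorph1 \pi_K).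
apply/Qp_pi_eq => e e0.
have [v v0 [a ha]] :=
  padic_cauchy_stab p_pr (padic_seq_cauchy (repr x)) (Qp_repr_null x0).
exists a => n an.
rewrite -[X in padic_abs _ X]/((repr x n)^-1 * repr x n - 1) mulVf.
  by rewrite subrr padic_abs0.
by rewrite -(padic_abs_eq0 p_pr) ha // gt_eqF.
Qed.

Lemma Qp_inv0 : Qp_inv 0 = 0.
Proof. by rewrite /Qp_inv; case: pselect => // h; case/eqP: (h). Qed.

HB.instance Definition _ :=
  GRing.ComNzRing_isField.Build K Qp_mulVf Qp_inv0.

(* |x| is the limit of |u n|, for u any Cauchy sequence representing x. *)
Definition Qp_abs (x : K) : rat := get (padic_abs_lim p (repr x)).

Lemma Qp_abs_lim (u : T) : padic_abs_lim p u (Qp_abs (\pi_K u)).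
Proof.
have [l ul] := padic_abs_lim_ex p_pr (padic_seq_cauchy u).
rewrite /Qp_abs; case: xgetP => [r _ hr|].
  rewrite (padic_abs_lim_eq p_pr _ hr ul) //.
  by apply/Qp_pi_eq; rewrite reprK.
have [m um] :=
  padic_abs_lim_ex p_pr (padic_seq_cauchy (repr (\pi_K u))).
by move=> /(_ m).
Qed.

Lemma Qp_absP (u : T) l : padic_abs_lim p u l -> Qp_abs (\pi_K u) = l.
Proof.
move=> ul; apply: (padic_abs_lim_eq p_pr _ (Qp_abs_lim u) ul).
by rewrite subrr => e e0; exists 0%N => n _; rewrite padic_abs0.
Qed.

Lemma Qp_abs0 : Qp_abs 0 = 0.
Proof.
rewrite -(rmorph0 \pi_K); apply: Qp_absP => e e0.
by exists 0%N => n _; rewrite padic_abs0 subrr normr0.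
Qed.

Lemma Qp_abs_eq0 (x : K) : Qp_abs x = 0 -> x = 0.
Proof.
rewrite -[x]reprK => h; have := Qp_abs_lim (repr x).
rewrite h => xl; apply/Qp_pi_eq0 => e /xl[a ha]; exists a => n an.
by have := ha n an; rewrite subr0 ger0_norm ?padic_abs_ge0.
Qed.

Lemma Qp_absN (x : K) : Qp_abs (- x) = Qp_abs x.
Proof.
rewrite -[x]reprK -rmorphN; apply: Qp_absP => e e0.
have [a ha] := Qp_abs_lim (repr x) e0; exists a => n an.
by rewrite -[X in padic_abs _ X]/(- repr x n) padic_absN // ha.
Qed.

Lemma Qp_absD (x y : K) : Qp_abs (x + y) <= Qp_abs x + Qp_abs y.
Proof.
rewrite -[x]reprK -[y]reprK -rmorphD; apply/ler_addgt0Pl => e e0.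
have e3 : 0 < e / 3 by rewrite divr_gt0.
have [k hk] := Qp_abs_lim (repr x + repr y) e3.
have [l hl] := Qp_abs_lim (repr x) e3; have [m hm] := Qp_abs_lim (repr y) e3.
pose n := maxn k (maxn l m).
have := hk n (leq_maxl _ _).
rewrite -[X in padic_abs p X]/(repr x n + repr y n).
have := hl n (leq_trans (leq_maxl _ _) (leq_maxr _ _)).
have := hm n (leq_trans (leq_maxr _ _) (leq_maxr _ _)).
have := padic_absD p_pr (repr x n) (repr y n).
rewrite !ltr_norml => h1 /andP[h2 h3] /andP[h4 h5] /andP[h6 h7]; lra.
Qed.

Lemma Qp_absM (x y : K) : Qp_abs (x * y) = Qp_abs x * Qp_abs y.
Proof.
have [->|x0] := eqVneq x 0; first by rewrite !(mul0r, Qp_abs0).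
have [->|y0] := eqVneq y 0; first by rewrite !(mulr0, Qp_abs0).
have st (z : K) : z != 0 ->
    exists a, forall n, (a <= n)%N -> padic_abs p (repr z n) = Qp_abs z.
  move=> z0; have [v v0 [a ha]] :=
    padic_cauchy_stab p_pr (padic_seq_cauchy (repr z)) (Qp_repr_null z0).
  exists a => n an; rewrite ha // -[z in RHS]reprK; apply/esym/Qp_absP.
  by move=> e e0; exists a => m am; rewrite ha // subrr normr0.
have [a ha] := st _ x0; have [b hb] := st _ y0.
rewrite -[x in LHS]reprK -[y in LHS]reprK -rmorphM; apply: Qp_absP => e e0.
exists (maxn a b) => n; rewrite geq_max => /andP[an bn].
rewrite -[X in padic_abs p X]/(repr x n * repr y n).
by rewrite padic_absM // ha // hb // subrr normr0.
Qed.

Definition Qp_dist (x y : K) : rat := Qp_abs (x - y).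

Lemma Qp_distxx x : Qp_dist x x = 0.
Proof. by rewrite /Qp_dist subrr Qp_abs0. Qed.

Lemma Qp_dist_eq0 x y : Qp_dist x y = 0 -> x = y.
Proof. by move=> /Qp_abs_eq0/eqP; rewrite subr_eq0 => /eqP. Qed.

Lemma Qp_dist_sym x y : Qp_dist x y = Qp_dist y x.
Proof. by rewrite /Qp_dist -Qp_absN opprB. Qed.

Lemma Qp_dist_triangle y x z : Qp_dist x z <= Qp_dist x y + Qp_dist y z.
Proof. by rewrite /Qp_dist -(subrKA y) Qp_absD. Qed.

HB.instance Definition _ := isPointed.Build K 0.

HB.instance Definition _ := isMetric.Build rat K
  Qp_distxx Qp_dist_eq0 Qp_dist_sym Qp_dist_triangle.

Lemma Qp_ballE (x : K) (e : rat) (y : K) : ball x e y = (Qp_dist x y < e) :> Prop.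
Proof. by rewrite ballEmdist. Qed.

Definition padic_cst (q : rat) : T :=
  PadicCauchySeq (asboolT (padic_cauchy_cst p q)).

Lemma Qp_pi_int (z : int) : \pi_K (padic_cst z%:~R) = z%:~R.
Proof.
rewrite -(rmorph_int \pi_K); congr \pi_K; apply/val_inj; rewrite rmorph_int.
apply/funext => n /=.
have h k : (k%:R : nat -> rat) n = k%:R.
  by elim: k => // k IH; rewrite !mulrS -IH.
case: z => k; rewrite ?NegzE ?mulrNz -?pmulrn; first by rewrite h.
by rewrite -[RHS]/(- (k.+1%:R : nat -> rat) n) h.
Qed.

Lemma Qp_ratrE (q : rat) : ratr q = \pi_K (padic_cst q).
Proof.
have d0 : (denq q)%:~R != 0 :> K.
  apply/eqP; rewrite -Qp_pi_int => /Qp_pi_eq0 h.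
  have d1 : 0 < padic_abs p (denq q)%:~R.
    rewrite lt_neqAle padic_abs_ge0 // eq_sym padic_abs_eq0 // intr_eq0.
    by rewrite denq_neq0.
  by have [a /(_ a (leqnn a))] := h _ d1; rewrite /= ltxx.
apply: (mulIf d0); rewrite /ratr divfK // -!Qp_pi_int -rmorphM.
congr \pi_K; apply/val_inj/funext => n /=.
by rewrite -[RHS]/(q * (denq q)%:~R) numqE.
Qed.

Lemma Qp_abs_ratr (q : rat) : Qp_abs (ratr q) = padic_abs p q.
Proof.
rewrite Qp_ratrE; apply: Qp_absP => e e0.
by exists 0%N => n _; rewrite subrr normr0.
Qed.

Lemma Qp_dist_ratr (q r : rat) : Qp_dist (ratr q) (ratr r) = padic_abs p (q - r).
Proof.
rewrite /Qp_dist !Qp_ratrE -rmorphB; apply: Qp_absP => e e0.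
by exists 0%N => n _; rewrite subrr normr0.
Qed.

Lemma Qp_approx (x : K) (e : rat) : 0 < e ->
  exists q : rat, Qp_dist x (ratr q) < e.
Proof.
move=> e0; have e2 : 0 < e / 2 by rewrite divr_gt0.
have [a ha] := padic_seq_cauchy (repr x) e2.
exists (repr x a); rewrite /Qp_dist Qp_ratrE -[x in x - _]reprK -rmorphB.
have [b hb] := Qp_abs_lim (repr x - padic_cst (repr x a)) e2.
have := hb _ (leq_maxr a b); rewrite distrC.
have := ha (maxn a b) a (leq_maxl _ _) (leqnn _).
rewrite -[X in `|_ - padic_abs p X|]/(repr x (maxn a b) - repr x a).
rewrite ltr_norml => h1 /andP[_ h2]; lra.
Qed.

Lemma dense_ratr : dense (range (@ratr K)).
Proof.
move=> O [x Ox] oO.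
have /nbhs_ballP[e /= e0 xe] : nbhs x O by exact: open_nbhs_nbhs.
have [q hq] := Qp_approx x e0.
by exists (ratr q); split; [apply: xe; rewrite Qp_ballE|exists q].
Qed.

Lemma Qp_complete (F : set_system K) : ProperFilter F -> cauchy F -> cvg F.
Proof.
move=> FF /cauchyP Fc.
pose eps (n : nat) : rat := n.+1%:R^-1.
have eps0 n : 0 < eps n by rewrite invr_gt0.
have epsle m n : (m <= n)%N -> eps n <= eps m.
  by move=> mn; rewrite lef_pV2 ?posrE // ler_nat.
have epse (e : rat) : 0 < e -> exists n, eps n < e.
  move=> e0; have [n hn] : exists n : nat, e^-1 < n%:R.
    by exists (Num.bound e^-1); rewrite archi_boundP // ltW // invr_gt0.
  exists n; rewrite invf_plt ?posrE //.
  by apply: (lt_trans hn); rewrite ltr_nat.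
have exq : forall n, exists q : rat,
    F (ball (ratr q : K) (eps n)).
  move=> n.
  have [|x Fx] := Fc (eps n / 2); first by rewrite divr_gt0.
  have [|q xq] := @Qp_approx x (eps n / 2); first by rewrite divr_gt0.
  exists q; apply: filterS Fx => y xy; rewrite [eps n]splitr.
  by apply: ball_triangle xy; rewrite Qp_ballE Qp_dist_sym.
have [q hq] := boolp.choice exq.
have qd m n : Qp_dist (ratr (q m)) (ratr (q n)) < eps m + eps n.
  have [y [my ny]] := filter_ex (filterI (hq m) (hq n)).
  by have := ball_triangle my (ball_sym ny); rewrite Qp_ballE.
have cq : padic_cauchy p q.
  move=> e e0; have [|a ha] := epse (e / 2); first by rewrite divr_gt0.
  exists a => m n am an; have := qd m n; rewrite Qp_dist_ratr.
  move=> /lt_trans; apply; have := epsle _ _ am; have := epsle _ _ an; lra.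
pose u : T := PadicCauchySeq (asboolT cq).
apply/cvg_ex; exists (\pi_K u : K); apply/cvg_ballP => e e0.
have e4 : 0 < e / 4 by rewrite divr_gt0.
have [a ha] := epse _ e4; have [b hb] := cq _ e4.
pose n := maxn a b.
apply: filterS (hq n) => y ny.
suff ul : ball (\pi_K u : K) (e / 2) (ratr (q n)).
  have := ball_triangle ul ny; apply: le_ball.
  have := epsle _ _ (leq_maxl a b); rewrite -/n; lra.
rewrite Qp_ballE /Qp_dist Qp_ratrE -rmorphB.
have [c hc] := Qp_abs_lim (u - padic_cst (q n)) e4.
have := hc _ (leq_maxr b c); rewrite distrC.
have := hb (maxn b c) n (leq_maxl _ _) (leq_maxr _ _).
rewrite -[X in `|_ - padic_abs p X|]/(q (maxn b c) - q n).
rewrite ltr_norml => h1 /andP[_ h2]; lra.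
Qed.

HB.instance Definition _ := Uniform_isComplete.Build K Qp_complete.

End QpField.

(* Main.v *)
(* With d = x1 - a x0 one has a x_n = a^n (a x0 + n d).  Let r / s be a rational
   target and k large.  As d and p - 1 are prime to p, there are m and
   n = m + (p - 1) p^k c with a x0 + m d = s p^k and a x0 + n d = r p^k modulo
   p^(2k).  Euler's theorem gives a^(n - m) = 1 modulo p^k, hence
   x_n / x_m = (r + O(p^k)) / (s + O(p^k)), which is close to r / s. *)
Require Import Defs.
From mathcomp Require Import all_boot all_order all_algebra.
From mathcomp Require Import cyclic.
From mathcomp Require Import all_classical all_reals all_analysis.
From mathcomp Require Import ring.

Import Order.TTheory GRing.Theory Num.Theory.
Local Open Scope classical_set_scope.
Local Open Scope ring_scope.

(** The characteristic polynomial (X - a)^2 has the double root [a], so a solution is a^n times an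
    affine function of [n]. The extra factor [a] on the left avoids a^(n-1), which is no integer
    power at [n] = 0. *)
Lemma double_root_recurrence (a : int) (x : nat -> int)
    (hx : forall n : nat, (2 <= n)%N ->
      x n = 2 * a * x (n - 1)%N - a ^+ 2 * x (n - 2)%N) (n : nat) :
  a * x n = a ^+ n * (a * x 0%N + n%:Z * (x 1%N - a * x 0%N)).
Proof.
suff [] : a * x n = a ^+ n * (a * x 0%N + n%:Z * (x 1%N - a * x 0%N)) /\
  a * x n.+1 = a ^+ n.+1 * (a * x 0%N + n.+1%:Z * (x 1%N - a * x 0%N)) by [].
elim: n => [|n [IH0 IH1]]; first by split; ring.
split=> //; rewrite hx // subn2 subn1 /=.
have -> : a * (2 * a * x n.+1 - a ^+ 2 * x n) =
  2 * a * (a * x n.+1) - a ^+ 2 * (a * x n) by ring.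
by rewrite IH0 IH1 !exprS !intS; ring.
Qed.

Lemma coprimez_primeX (p : nat) (p_pr : prime p) (D : int) (K : nat) :
  ~~ (p%:Z %| D)%Z -> coprimez (p%:Z ^+ K) D.
Proof.
by move=> pD; apply/coprimezXl; rewrite coprimezE /= prime_coprime.
Qed.

(** A Bezout relation u p^K + v D = 1 makes v z a solution; its residue modulo p^K is nonnegative,
    hence usable as an index. *)
Lemma linear_congruence_nat (p : nat) (p_pr : prime p) (D : int) (K : nat)
    (z : int) :
  ~~ (p%:Z %| D)%Z -> exists N : nat, (p%:Z ^+ K %| D * N%:Z - z)%Z.
Proof.
move=> /(coprimez_primeX _ p_pr _ K) /coprimezP[[u v] /= e].
have P0 : p%:Z ^+ K != 0 by rewrite expf_neq0 // gt_eqF // ltz_nat prime_gt0.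
exists `|((v * z) %% p%:Z ^+ K)%Z|%N; rewrite gez0_abs ?modz_ge0 //.
apply/dvdzP; exists (- (z * u) - D * ((v * z) %/ p%:Z ^+ K)%Z).
rewrite /modz; set r := (_ %/ _)%Z.
have -> : D * (v * z - r * p%:Z ^+ K) - z =
    (- (z * u) - D * r) * p%:Z ^+ K + z * (u * p%:Z ^+ K + v * D - 1) by ring.
by rewrite e subrr mulr0 addr0.
Qed.

(** The totient of p^(k+1) is (p - 1) p^k, so the congruence even holds modulo p^(k+1). Working at
    exponent k + 1 also covers [k] = 0. *)
Lemma Euler_int_primeX (p : nat) (p_pr : prime p) (a : int) (k c : nat) :
  ~~ (p%:Z %| a)%Z -> (p%:Z ^+ k %| a ^+ (p.-1 * (p ^ k * c)) - 1)%Z.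
Proof.
move=> pa; have P0 : p%:Z ^+ k.+1 != 0.
  by rewrite expf_neq0 // gt_eqF // ltz_nat prime_gt0.
apply: (@dvdz_trans (p%:Z ^+ k.+1)); first by rewrite exprS dvdz_mull.
rewrite -eqz_mod_dvd -modzXm.
(* Euler's theorem concerns natural numbers, so [a] is replaced by its residue. *)
set b := (a %% _)%Z; have [n bn] : exists n : nat, b = n%:Z.
  by exists `|b|%N; rewrite gez0_abs ?modz_ge0.
have cn : coprime n (p ^ k.+1).
  have := coprimez_primeX _ p_pr _ k.+1 pa.
  rewrite /coprimez -gcdz_modr -/b bn.
  by rewrite coprime_sym /coprime /gcdz /= abszX.
have := Euler_exp_totient cn; rewrite totient_pfactor //= => h.
rewrite bn mulnA exprM -modzXm.
have -> : (n%:Z ^+ (p.-1 * p ^ k) %% p%:Z ^+ k.+1)%Z = (1 %% p%:Z ^+ k.+1)%Z.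
  by rewrite -!rmorphXn /= !modz_nat natrXE h.
by rewrite modzXm expr1n.
Qed.

Section PadicAbs.
Variables (p : nat) (p_pr : prime p).
Local Notation N := (padic_abs p).

Lemma padic_abs_int_le1 (z : int) : N z%:~R <= 1.
Proof.
have [->|z0] := eqVneq z 0; first by rewrite padic_abs0.
rewrite -[z%:~R]divr1 (padic_abs_frac _ _ (n := 1)) //= logn1 sub0r.
rewrite -exprnN invf_le1 ?exprn_gt0 ?ltr0n ?prime_gt0 //.
by rewrite exprn_ege1 // ler1n prime_gt0.
Qed.

Lemma padic_abs_primeX (k : nat) : N (p%:Z ^+ k)%:~R = p%:R ^- k.
Proof.
have P0 : p%:Z ^+ k != 0 by rewrite expf_neq0 // gt_eqF // ltz_nat prime_gt0.
rewrite -[_%:~R]divr1 (padic_abs_frac _ _ (n := 1)) //= logn1 sub0r.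
by rewrite abszX pfactorK // exprnN.
Qed.

Lemma padic_abs_dvdz (k : nat) (z : int) :
  (p%:Z ^+ k %| z)%Z -> N z%:~R <= p%:R ^- k.
Proof.
move=> /dvdzP[w ->]; rewrite rmorphM /= padic_absM // padic_abs_primeX.
by rewrite ler_piMl ?padic_abs_int_le1 // invr_ge0 exprn_ge0 // ler0n.
Qed.

Lemma primeX_inv_lt (e : rat) : 0 < e -> exists k : nat, p%:R ^- k < e.
Proof.
(* Since p^k > k, any k above 1/e works. *)
move=> e0; exists (Num.bound e^-1).
rewrite invf_plt ?posrE ?exprn_gt0 ?ltr0n ?prime_gt0 //.
apply: (@lt_trans _ _ (Num.bound e^-1)%:R).
  by rewrite archi_boundP // invr_ge0 ltW.
by rewrite -natrX ltr_nat ltn_expl ?prime_gt1.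
Qed.

(** If p^-k < |s|, then |s'| = |s| by the ultrametric inequality. The difference of the fractions
    has numerator divisible by p^k and denominator of absolute value |s|^2, so p^-k < e |s|^2
    suffices. *)
Lemma frac_approx (r s : int) (e : rat) : s != 0 -> 0 < e ->
  exists k : nat, forall r' s' : int,
    (p%:Z ^+ k %| r' - r)%Z -> (p%:Z ^+ k %| s' - s)%Z ->
    s' != 0 /\ N (r%:~R / s%:~R - r'%:~R / s'%:~R) < e.
Proof.
move=> s0 e0; have sQ : s%:~R != 0 :> rat by rewrite intr_eq0.
have S0 : 0 < N s%:~R.
  by rewrite lt_neqAle padic_abs_ge0 // eq_sym padic_abs_eq0 ?sQ.
have [|k] := primeX_inv_lt (Num.min (N s%:~R) (e * (N s%:~R * N s%:~R))).
  by rewrite lt_min S0 !mulr_gt0.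
rewrite lt_min => /andP[k1 k2]; exists k => r' s' hr hs.
have es : N s'%:~R = N s%:~R.
  apply: padic_abs_isosceles => //.
  by rewrite -rmorphB /= (le_lt_trans (padic_abs_dvdz _ _ hs)).
have s'Q : s'%:~R != 0 :> rat by rewrite -(padic_abs_eq0 p_pr) es gt_eqF.
split; first by rewrite intr_eq0 in s'Q.
have -> : r%:~R / s%:~R - r'%:~R / s'%:~R =
    (r * (s' - s) - s * (r' - r))%:~R / (s%:~R * s'%:~R) :> rat.
  by rewrite rmorphB !rmorphM !rmorphB /=; field; rewrite sQ s'Q.
rewrite padic_absM // padic_absV // padic_absM // es ltr_pdivrMr ?mulr_gt0 //.
apply: le_lt_trans k2; apply: padic_abs_dvdz.
by apply: rpredB; apply: dvdz_mull.
Qed.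

End PadicAbs.

Theorem theorem1p7 (a x0 x1 : int) (x : nat -> int)
  (hx0 : x 0%N = x0) (hx1 : x 1%N = x1)
  (hx : forall n : nat, (2 <= n)%N ->
    x n = 2 * a * x (n - 1)%N - a ^+ 2 * x (n - 2)%N)
  (p : nat) (p_pr : prime p) (hp : ~~ (p%:Z %| a * (x1 - a * x0))%Z) :
  dense ((ratr : rat -> Qp p_pr) @` quotient_set (range x)).
Proof.
move=> O [y Oy] oO.
(* By density of the rationals, the target may be taken to be a rational [q] in [O]. *)
have [z [Oz [q _ qz]]] := dense_ratr (ex_intro _ y Oy) oO.
have /nbhs_ballP[e /= e0 qe] : nbhs (ratr q : Qp p_pr) O.
  by apply: open_nbhs_nbhs; rewrite qz.
set d := x1 - a * x0 in hp.
have pa : ~~ (p%:Z %| a)%Z by apply: contra hp; exact: dvdz_mulr.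
have pd : ~~ (p%:Z %| d)%Z by apply: contra hp; exact: dvdz_mull.
have pP : ~~ (p%:Z %| d * p.-1%:Z)%Z.
  rewrite dvdzE abszM /= Euclid_dvdM // negb_or; apply/andP; split=> //.
  by case: (p) (prime_gt1 p_pr) => [|[|p']] // _; rewrite gtnNdvd.
have [k hk] := frac_approx p p_pr (numq q) (denq q) e (denq_neq0 q) e0.
set P := p%:Z ^+ k.
have P0 : P != 0 by rewrite expf_neq0 // gt_eqF // ltz_nat prime_gt0.
(* Precision p^(2k) is required because a factor p^k cancels in the quotient, leaving an error
   O(p^k). *)
have [M /dvdzP[v hM]] :=
  linear_congruence_nat p p_pr _ (k + k) (denq q * P - a * x0) pP.
(* Here p^k is enough, since the shift n - m = (p - 1) p^k c already carries a factor p^k. *)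
have [c /dvdzP[w hc]] := linear_congruence_nat p p_pr _ k (numq q - denq q) pP.
have /dvdzP[t ht] := Euler_int_primeX p p_pr a k c pa.
pose m := (p.-1 * M)%N; pose n := (m + p.-1 * (p ^ k * c))%N.
rewrite exprD -/P in hM; rewrite -/P in hc ht.
(* These are the exact cofactors: a x0 + m d = P s' and a x0 + n d = P r', while a^(n - m) = 1 + t
   P. *)
pose s' := denq q + v * P; pose r' := numq q + (v + w) * P.
have xm : a * x m = a ^+ m * (P * s').
  rewrite (double_root_recurrence a x hx) hx0 hx1 -/d /m PoszM.
  have -> : P * s' = denq q * P + v * (P * P) by rewrite /s'; ring.
  by congr (_ * _); rewrite -hM; ring.
have xn : a * x n = a ^+ m * (P * ((1 + t * P) * r')).
  rewrite (double_root_recurrence a x hx) hx0 hx1 -/d /n exprD.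
  have -> : a ^+ (p.-1 * (p ^ k * c)) = 1 + t * P by rewrite -ht; ring.
  have -> : (m + p.-1 * (p ^ k * c))%N%:Z = p.-1%:Z * M%:Z + p.-1%:Z * (P * c%:Z).
    by rewrite PoszD !PoszM /P -rmorphXn /= natrXE.
  have -> : P * ((1 + t * P) * r') = (1 + t * P) *
    (denq q * P + v * (P * P) + P * (numq q - denq q + w * P)).
    by rewrite /r'; ring.
  by rewrite -mulrA; congr (_ * (_ * _)); rewrite -hM -hc; ring.
have [||s'0 hN] := hk ((1 + t * P) * r') s'.
- by apply/dvdzP; exists (v + w + t * r'); rewrite /r'; ring.
- by apply/dvdzP; exists v; rewrite /s'; ring.
have a0 : a != 0 by apply: contraNneq pa => ->; rewrite dvdz0.
have am0 : a ^+ m != 0 by rewrite expf_neq0.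
have xm0 : x m != 0.
  have : a * x m != 0 by rewrite xm !mulf_neq0.
  by apply: contraNneq => ->; rewrite mulr0.
exists (ratr (((x n)%:~R : rat) / (x m)%:~R)); split; last first.
  by exists ((x n)%:~R / (x m)%:~R) => //; exists (x n), (x m).
apply: qe; rewrite Qp_ballE Qp_dist_ratr -{1}(divq_num_den q).
suff -> : (x n)%:~R / (x m)%:~R = ((1 + t * P) * r')%:~R / s'%:~R :> rat by [].
apply/eqP; rewrite eqr_div ?intr_eq0 // -!intrM eqr_int; apply/eqP.
(* Multiplying by the nonzero a a^m P turns the cross-multiplied identity into one between the known
   values of a x_n and a x_m. *)
apply: (mulfI (mulf_neq0 a0 (mulf_neq0 am0 P0))).
have -> : a * (a ^+ m * P) * (x n * s') = (a * x n) * (a ^+ m * (P * s')) by ring.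
have -> : a * (a ^+ m * P) * ((1 + t * P) * r' * x m) =
  (a * x m) * (a ^+ m * (P * ((1 + t * P) * r'))) by ring.
by rewrite xm xn mulrC.
Qed.
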